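(* Let $z\in\mathbb{C}\setminus\{0\}$, $k\in\mathbb{Z}$, and denote by $(E_k)$ the equation $w+\log(w)=\log(z)+2k\pi i$ in the unknown $w$. (1) If $z\notin\,]-\infty,0[$, equation $(E_k)$ has a unique complex solution denoted $W_k(z)$, and we have $W_{-k}(z)=\overline{W_k(\bar z)}$. (2) If $z\in\,]-\infty,0[$ and $k\ne 0,-1$, or $z\in\,]-\infty,-1/e[$ and $k=0$ or $k=-1$, equation $(E_k)$ has a unique complex solution denoted $W_k(z)$, and we have $W_{-k}(z)=\overline{W_{k-1}(z)}$. (3) If $z\in[-1/e,0[$ and $k=-1$, equation $(E_k)$ has no solution (this is the only case in which there is no solution). (4) If $z\in[-1/e,0[$ and $k=0$, equation $(E_k)$ has two real solutions denoted $W_{-1}(z)$ and $W_0(z)$ characterized by $W_{-1}(z)\le -1\le W_0(z)$, which coincide if $z=-1/e$.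
   Context: $\log$ denotes the principal determination of the complex logarithm on $\mathbb{C}\setminus\{0\}$, with imaginary part in $]-\pi,\pi]$. $]a,b[$ denotes an open interval and $[a,b[$ a half-open interval containing $a$ but not $b$; $e=\exp(1)$; the bar denotes complex conjugation. For $z\in[-1/e,0[$ the values $W_0(z)$ and $W_{-1}(z)$ are those defined in (4).
   Formalization: In (2) the formula W_{-k}(z) = conj(W_{k-1}(z)) is not asserted for k = 1 and z in ]-1/e,0[, where it is false: it would equate the two distinct reals W_{-1}(z) < -1 < W_0(z) of (4). *)

(* Defs.v *)
From Stdlib Require Import Reals Lra ZArith ClassicalEpsilon.
From Coquelicot Require Import Coquelicot.

Open Scope R_scope.

(* Junk value at 0, where [_ / 0] is unspecified. *)
Definition Carg (z : C) : R :=
  if Rle_dec 0 (Im z) then acos (Re z / Cmod z) else - acos (Re z / Cmod z).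

Definition Clog (z : C) : C := (ln (Cmod z), Carg z).

Definition Cexp (z : C) : C := (exp (Re z) * cos (Im z), exp (Re z) * sin (Im z)).

Lemma Carg_polar (z : C) : z <> 0%C ->
  z = (Cmod z * cos (Carg z), Cmod z * sin (Carg z)) /\ - PI < Carg z <= PI.
Proof.
intros Hz.
assert (Hr : 0 < Cmod z) by now apply Cmod_gt_0.
assert (Hsq : Cmod z * Cmod z = Re z * Re z + Im z * Im z).
{ unfold Cmod; rewrite sqrt_sqrt by (destruct z; simpl; nra).
  destruct z; simpl; ring. }
assert (Hu2 : Rsqr (Re z / Cmod z) = 1 - Rsqr (Im z / Cmod z)).
{ unfold Rsqr; field_simplify_eq; [nra | lra]. }
assert (Hb : -1 <= Re z / Cmod z <= 1).
{ assert (H := Rle_0_sqr (Im z / Cmod z)); unfold Rsqr in *; nra. }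
assert (Hsin : sin (acos (Re z / Cmod z)) = Rabs (Im z) / Cmod z).
{ rewrite sin_acos by exact Hb.
  replace (1 - Rsqr (Re z / Cmod z)) with (Rsqr (Im z / Cmod z)) by lra.
  rewrite sqrt_Rsqr_abs; unfold Rdiv; rewrite Rabs_mult.
  rewrite (Rabs_pos_eq (/ Cmod z)); [reflexivity|].
  left; now apply Rinv_0_lt_compat. }
assert (Hcos : cos (acos (Re z / Cmod z)) = Re z / Cmod z) by now apply cos_acos.
assert (Hacos := acos_bound (Re z / Cmod z)).
assert (Hpi := PI_RGT_0).
unfold Carg; destruct (Rle_dec 0 (Im z)) as [Hi | Hi].
- split; [|lra].
  rewrite Hcos, Hsin, Rabs_pos_eq by exact Hi.
  destruct z as [x y]; simpl in *; f_equal; field; lra.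
- split.
  + rewrite cos_neg, sin_neg, Hcos, Hsin, Rabs_left by lra.
    destruct z as [x y]; simpl in *; f_equal; field; lra.
  + split; [|lra].
    destruct (Rle_lt_or_eq_dec _ _ (proj2 Hacos)) as [H | H]; [lra|].
    rewrite H, sin_PI, Rabs_left in Hsin by lra.
    assert (- Im z / Cmod z > 0) by (apply Rdiv_lt_0_compat; lra).
    lra.
Qed.

Lemma Clog_principal (z : C) : z <> 0%C ->
  Cexp (Clog z) = z /\ - PI < Im (Clog z) <= PI.
Proof.
intros Hz; destruct (Carg_polar z Hz) as [Hp Hb]; split; [|exact Hb].
unfold Cexp, Clog; simpl.
rewrite exp_ln by now apply Cmod_gt_0.
now symmetry.
Qed.

(* The equation (E_k): w + log w = log z + 2 k pi i; log is only defined off 0. *)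
Definition lambert_eq (z : C) (k : Z) (w : C) : Prop :=
  w <> 0%C /\
  (w + Clog w = Clog z + 2 * RtoC (IZR k) * RtoC PI * Ci)%C.

Definition Cneg_ray (a : R) (z : C) : Prop := Im z = 0 /\ Re z < a.

Definition lambert_cut (z : C) : Prop := Im z = 0 /\ - / exp 1 <= Re z < 0.

(* On [-1/e, 0[ both W_0(z) and W_{-1}(z) solve (E_0), and are told apart by
   their position with respect to -1. *)
Definition is_lambertW (k : Z) (z w : C) : Prop :=
  (lambert_cut z /\ k = 0%Z /\
     lambert_eq z 0 w /\ Im w = 0 /\ -1 <= Re w) \/
  (lambert_cut z /\ k = (-1)%Z /\
     lambert_eq z 0 w /\ Im w = 0 /\ Re w <= -1) \/
  (~ (lambert_cut z /\ (k = 0%Z \/ k = (-1)%Z)) /\ lambert_eq z k w).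

Definition lambertW (k : Z) (z : C) : C :=
  epsilon (inhabits (RtoC 0)) (is_lambertW k z).

(* Main.v *)
Require Import Defs.
From Stdlib Require Import Reals ZArith Lra Lia Psatz ClassicalEpsilon.
From Coquelicot Require Import Coquelicot.

(** Write [w = X (cos th + i sin th)] with [X = |w|] and [th = Arg w].  Taking
    real and imaginary parts of [(E_k)] and exponentiating the real part turns
    it into the two real equations [|w| exp (Re w) = r] and
    [Im w + Arg w = c], where [r = |z|] and [c = Arg z + 2 k PI]
    ([polar_lambert], [lambert_eq_polar]).  So everything depends on the pair
    [(r, c)] only, with [r > 0] and [c] an arbitrary real number.

    [Im w] and [Arg w] have the same sign unless [w] is a negative real, where
    they are [0] and [PI].  Hence solutions in the open upper half plane
    need [c > 0], those in the lower half plane [c < 0], positive real ones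
    [c = 0] and negative real ones [c = PI] ([polar_lambert_position]).
    Conjugation exchanges the two half planes and changes the sign of [c].

    In the upper half plane, the second equation leaves the single parameter
    [th], with [0 < th < min (c, PI)]: the point of argument [th] and imaginary
    part [c - th] has modulus [X = (c - th) / sin th], and the first equation
    becomes [h th = r] for [h th = X exp (X cos th)] ([ray_modulus]).  The
    derivative of [h] is [- |1 + w|^2 exp (Re w) / sin th], so [h] is strictly
    decreasing ([ray_modulus_decreasing]).  It tends to infinity at [0].  At the
    other end it tends to [0], except for [c = PI], when its limit is [1/e]
    ([ray_modulus_PI_lim]): then [w] approaches the critical point [-1] of
    [w + log w].  So for [c > 0] there is exactly one solution in the upper half
    plane, unless [c = PI] and [r <= 1/e], when there is none.

    On the real line the equation is [u exp u = r] for [c = 0], with one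
    positive root, and [u exp u = - r] with [u < 0] for [c = PI], which has a
    root on each side of [-1] when [r < 1/e], the double root [-1] when
    [r = 1/e], and none otherwise.

    Altogether there is exactly one solution unless [r <= 1/e] and [c] is [PI]
    or [- PI] ([exceptional]); in that case the solutions are the real ones for
    [c = PI], and there are none for [c = - PI].  Since [Arg z] lies in
    [(-PI, PI]], these exceptions are [z] in [[-1/e, 0)] with [k = 0] and with
    [k = -1] respectively ([exceptional_iff]).  The conjugation formulas follow
    from uniqueness, except at [z = -1/e], [k = 1], where both sides are [-1]. *)

(** * Intermediate values and the real function [u exp u] *)

Lemma ivt_between (f : R -> R) (x y r : R) :
  x <= y -> (forall t, x <= t <= y -> continuity_pt f t) ->
  f x <= r <= f y \/ f y <= r <= f x -> exists t, x <= t <= y /\ f t = r.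
Proof.
intros Hxy Hc Hr.
destruct (Req_dec (f x) r) as [E | Ex]; [exists x; split; [lra | exact E]|].
destruct (Req_dec (f y) r) as [E | Ey]; [exists y; split; [lra | exact E]|].
assert (Hlt : x < y) by (destruct Hxy as [H | H]; [exact H | subst; lra]).
destruct Hr as [Hr | Hr].
- destruct (Ranalysis5.IVT_interv (fun t => f t - r) x y) as [t [Ht E]];
    try lra.
  + intros t Ht; apply continuity_pt_minus; [now apply Hc|].
    apply continuity_pt_const; now intros ? ?.
  + exists t; split; [exact Ht | lra].
- destruct (Ranalysis5.IVT_interv (fun t => r - f t) x y) as [t [Ht E]];
    try lra.
  + intros t Ht; apply continuity_pt_minus; [|now apply Hc].
    apply continuity_pt_const; now intros ? ?.
  + exists t; split; [exact Ht | lra].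
Qed.

(** A quantitative form of the decay of [y exp (- y / 2)], used to find points
    where continuous functions fall below a given positive level. *)
Lemma mul_exp_neg_half_le (y : R) : 0 < y -> y * exp (- (y / 2)) <= 16 / y.
Proof.
intros Hy.
(* Squaring [y / 4 <= exp (y / 4)] gives [y^2 / 16 <= exp (y / 2)]. *)
assert (H := exp_ineq1_le (y / 4)).
assert (E : exp (- (y / 2)) * (exp (y / 4) * exp (y / 4)) = 1).
{ rewrite <- !exp_plus, <- exp_0; f_equal; lra. }
assert (Hp := exp_pos (- (y / 2))).
apply Rmult_le_reg_r with y; [exact Hy|].
replace (16 / y * y) with 16 by (field; lra).
assert (exp (- (y / 2)) * (y / 4 * (y / 4)) <= 1) by (rewrite <- E; nra).
lra.
Qed.

Lemma is_derive_mul_exp (u : R) :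
  is_derive (fun u => u * exp u) u ((1 + u) * exp u).
Proof. auto_derive; [exact I | ring]. Qed.

Lemma continuity_mul_exp (u : R) : continuity_pt (fun u => u * exp u) u.
Proof.
apply continuity_pt_filterlim, (ex_derive_continuous (fun u => u * exp u)).
eexists; apply is_derive_mul_exp.
Qed.

Lemma mul_exp_increasing (u v : R) : -1 <= u -> u < v -> u * exp u < v * exp v.
Proof.
intros Hu Huv.
destruct (MVT_cor2 (fun u => u * exp u) (fun u => (1 + u) * exp u) u v Huv)
  as [t [E Ht]].
{ intros t _; apply is_derive_Reals, is_derive_mul_exp. }
assert (Hp := exp_pos t).
assert (0 < (1 + t) * exp t) by (apply Rmult_lt_0_compat; lra).
nra.
Qed.

Lemma mul_exp_decreasing (u v : R) : v <= -1 -> u < v -> v * exp v < u * exp u.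
Proof.
intros Hv Huv.
destruct (MVT_cor2 (fun u => u * exp u) (fun u => (1 + u) * exp u) u v Huv)
  as [t [E Ht]].
{ intros t _; apply is_derive_Reals, is_derive_mul_exp. }
assert (Hp := exp_pos t).
assert ((1 + t) * exp t < 0) by nra.
nra.
Qed.

Lemma mul_exp_inj_right (u v : R) :
  -1 <= u -> -1 <= v -> u * exp u = v * exp v -> u = v.
Proof.
intros Hu Hv E; destruct (Rtotal_order u v) as [H | [H | H]]; [|exact H|].
- assert (K := mul_exp_increasing u v Hu H); lra.
- assert (K := mul_exp_increasing v u Hv H); lra.
Qed.

Lemma mul_exp_inj_left (u v : R) :
  u <= -1 -> v <= -1 -> u * exp u = v * exp v -> u = v.
Proof.
intros Hu Hv E; destruct (Rtotal_order u v) as [H | [H | H]]; [|exact H|].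
- assert (K := mul_exp_decreasing u v Hv H); lra.
- assert (K := mul_exp_decreasing v u Hu H); lra.
Qed.

Lemma mul_exp_m1 : -1 * exp (-1) = - / exp 1.
Proof.
replace (exp (-1)) with (/ exp 1) by (rewrite <- exp_Ropp; f_equal; lra); ring.
Qed.

Lemma mul_exp_ge (u : R) : - / exp 1 <= u * exp u.
Proof.
rewrite <- mul_exp_m1.
destruct (Rtotal_order u (-1)) as [H | [H | H]].
- left; apply mul_exp_decreasing; lra.
- rewrite H; lra.
- left; apply mul_exp_increasing; lra.
Qed.

Lemma mul_exp_two_roots (r : R) : 0 < r <= / exp 1 ->
  exists a b, a <= -1 <= b /\ a * exp a = - r /\ b * exp b = - r.
Proof.
intros Hr.
assert (Hm := mul_exp_m1).
destruct (ivt_between (fun u => u * exp u) (-1) 0 (- r)) as [b [Hb Eb]].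
{ lra. }
{ intros t _; apply continuity_mul_exp. }
{ left; lra. }
assert (Hs : 0 < 16 / r) by (apply Rdiv_lt_0_compat; lra).
(* At [- s] the function is at least [- r], because
   [s exp (- s) <= s exp (- s / 2) <= 16 / s <= r]. *)
set (s := 1 + 16 / r).
destruct (ivt_between (fun u => u * exp u) (- s) (-1) (- r)) as [a [Ha Ea]].
{ unfold s; lra. }
{ intros t _; apply continuity_mul_exp. }
{ right; split; [lra|].
  assert (H1 := mul_exp_neg_half_le s ltac:(unfold s; lra)).
  assert (H2 : exp (- s) < exp (- (s / 2))) by (apply exp_increasing; unfold s; lra).
  assert (H3 : 16 / s <= r).
  { apply Rmult_le_reg_r with s; [unfold s; lra|].
    replace (16 / s * s) with 16 by (field; unfold s; lra).
    unfold s; replace (r * (1 + 16 / r)) with (r + 16) by (field; lra); lra. }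
  assert (0 < s) by (unfold s; lra).
  nra. }
exists a, b; repeat split; lra.
Qed.

Lemma mul_exp_positive_root (r : R) : 0 < r -> exists u, 0 < u /\ u * exp u = r.
Proof.
intros Hr.
destruct (ivt_between (fun u => u * exp u) 0 r r) as [u [Hu E]].
{ lra. }
{ intros t _; apply continuity_mul_exp. }
{ left; split; [lra|].
  assert (H := exp_ineq1_le r); nra. }
exists u; split; [|exact E].
destruct (proj1 Hu) as [H | H]; [exact H|].
rewrite <- H, Rmult_0_l in E; lra.
Qed.

(** * Non-real solutions along a line [Im w = c - Arg w] *)

(** For [0 < th < PI] and [th < c], the modulus of the point [w] of argument
    [th] with [Im w = c - th]. *)
Definition ray_radius (c th : R) : R := (c - th) / sin th.

(** The value of [|w exp w|] at that same point [w]. *)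
Definition ray_modulus (c th : R) : R :=
  ray_radius c th * exp (ray_radius c th * cos th).

(** The sum of squares is [|1 + w|^2] for
    [w = ray_radius c th * (cos th + i sin th)]; written so, the derivative is
    visibly negative on [(0, PI)], where [w] is never [-1]. *)
Lemma is_derive_ray_modulus (c th : R) : sin th <> 0 ->
  is_derive (ray_modulus c) th
    (- ((1 + ray_radius c th * cos th)² + (ray_radius c th * sin th)²)
     * exp (ray_radius c th * cos th) / sin th).
Proof.
intros Hs; unfold ray_modulus, ray_radius, Rsqr.
auto_derive; [now repeat split|].
assert (Hcs := sin2_cos2 th); unfold Rsqr in Hcs.
set (E := exp _); set (s := sin th) in *; set (k := cos th) in *.
field_simplify_eq; [ring | exact Hs].
Qed.

Lemma continuity_ray_modulus (c th : R) :
  0 < th < PI -> continuity_pt (ray_modulus c) th.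
Proof.
intros Hth.
assert (Hs : 0 < sin th) by (apply sin_gt_0; lra).
apply continuity_pt_filterlim, (ex_derive_continuous (ray_modulus c)).
eexists; apply is_derive_ray_modulus; lra.
Qed.

Lemma ray_modulus_decreasing (c a b : R) :
  0 < a -> a < b -> b < PI -> ray_modulus c b < ray_modulus c a.
Proof.
intros Ha Hab Hb.
destruct (MVT_cor2 (ray_modulus c) (fun th =>
  - ((1 + ray_radius c th * cos th)² + (ray_radius c th * sin th)²)
     * exp (ray_radius c th * cos th) / sin th) a b Hab) as [t [E Ht]].
{ intros t Ht; apply is_derive_Reals, is_derive_ray_modulus.
  assert (0 < sin t) by (apply sin_gt_0; lra); lra. }
assert (Hs : 0 < sin t) by (apply sin_gt_0; lra).
set (X := ray_radius c t) in *.
assert (Hp : 0 < (1 + X * cos t)² + (X * sin t)²).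
{ assert (H1 := Rle_0_sqr (1 + X * cos t)).
  assert (H2 := Rle_0_sqr (X * sin t)).
  destruct (Req_dec X 0) as [H | H].
  - rewrite H; unfold Rsqr; lra.
  - assert (0 < (X * sin t)²); [|lra].
    apply Rsqr_pos_lt, Rmult_integral_contrapositive; split; lra. }
assert (He := exp_pos (X * cos t)).
assert (0 < ((1 + X * cos t)² + (X * sin t)²) * exp (X * cos t) / sin t * (b - a)).
{ apply Rmult_lt_0_compat; [|lra].
  apply Rdiv_lt_0_compat; [|exact Hs].
  now apply Rmult_lt_0_compat. }
unfold Rdiv in *; nra.
Qed.

Lemma ray_modulus_inj (c a b : R) : 0 < a < PI -> 0 < b < PI ->
  ray_modulus c a = ray_modulus c b -> a = b.
Proof.
intros Ha Hb E; destruct (Rtotal_order a b) as [H | [H | H]]; [|exact H|].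
- assert (K := ray_modulus_decreasing c a b ltac:(lra) H ltac:(lra)); lra.
- assert (K := ray_modulus_decreasing c b a ltac:(lra) H ltac:(lra)); lra.
Qed.

Lemma ray_modulus_at_end (c : R) : ray_modulus c c = 0.
Proof. unfold ray_modulus, ray_radius, Rdiv; ring. Qed.

(** Since [sin th <= th], for [th <= c / 2] the modulus is at least
    [c / (2 th)], and for [th <= PI / 2] the exponential factor is at least [1]. *)
Lemma ray_modulus_large (c r m : R) : 0 < c -> 0 < r -> 0 < m ->
  exists th, 0 < th < m /\ r <= ray_modulus c th.
Proof.
intros Hc Hr Hm.
assert (Hpi := PI_RGT_0).
assert (Hq : 0 < c / (2 * r)) by (apply Rdiv_lt_0_compat; lra).
set (th := Rmin (Rmin (c / 2) (m / 2)) (Rmin (PI / 2) (c / (2 * r)))).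
assert (H0 : 0 < th) by (unfold th; repeat apply Rmin_glb_lt; lra).
assert (H1 : th <= c / 2 /\ th <= m / 2 /\ th <= PI / 2 /\ th <= c / (2 * r)).
{ unfold th; repeat split; unfold Rmin; repeat destruct Rle_dec; lra. }
clearbody th; destruct H1 as (H1 & H2 & H3 & H4).
exists th; split; [lra|].
assert (Hs : 0 < sin th) by (apply sin_gt_0; lra).
assert (Hst := sin_lt_x th H0).
assert (Hk : 0 <= cos th) by (apply cos_ge_0; lra).
assert (HX : r <= ray_radius c th).
{ unfold ray_radius; apply Rmult_le_reg_r with (sin th); [exact Hs|].
  replace ((c - th) / sin th * sin th) with (c - th) by (field; lra).
  apply Rle_trans with (r * (c / (2 * r))).
  - apply Rmult_le_compat_l; lra.
  - replace (r * (c / (2 * r))) with (c / 2) by (field; lra); lra. }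
unfold ray_modulus.
assert (He := exp_ineq1_le (ray_radius c th * cos th)).
nra.
Qed.

(** For [c > PI], near [th = PI] the point goes to infinity in the direction of the negative real
    axis, where the exponential factor wins.  With [t = PI - th <= PI / 3] one
    has [cos th <= - 1 / 2], so the value is at most [X exp (- X / 2)]. *)
Lemma ray_modulus_small (c r : R) : PI < c -> 0 < r ->
  exists th, 0 < th < PI /\ ray_modulus c th <= r.
Proof.
intros Hc Hr.
assert (Hpi := PI_RGT_0).
assert (Hq : 0 < (c - PI) * r / 16) by (apply Rdiv_lt_0_compat; nra).
set (t := Rmin (PI / 3) ((c - PI) * r / 16)).
assert (H0 : 0 < t) by (unfold t; apply Rmin_glb_lt; lra).
assert (H1 : t <= PI / 3) by apply Rmin_l.
assert (H2 : t <= (c - PI) * r / 16) by apply Rmin_r.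
clearbody t.
exists (PI - t); split; [lra|].
assert (Hs : 0 < sin t) by (apply sin_gt_0; lra).
assert (Hst := sin_lt_x t H0).
assert (Hk : 1 / 2 <= cos t).
{ rewrite <- cos_PI3; apply cos_decr_1; lra. }
unfold ray_modulus.
assert (Ec : cos (PI - t) = - cos t) by apply Rtrigo_facts.cos_pi_minus.
rewrite Ec.
set (X := ray_radius c (PI - t)).
assert (HXs : X * sin t = c - (PI - t)).
{ unfold X, ray_radius; rewrite sin_PI_x; field; lra. }
assert (HX : 0 < X) by nra.
apply Rle_trans with (X * exp (- (X / 2))).
{ apply Rmult_le_compat_l; [lra|].
  assert (X * - cos t <= - (X / 2)) as [H | H] by nra.
  - left; now apply exp_increasing.
  - rewrite H; lra. }
apply Rle_trans with (16 / X); [now apply mul_exp_neg_half_le|].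
apply Rmult_le_reg_r with X; [exact HX|].
replace (16 / X * X) with 16 by (field; lra).
assert (Ht : c - PI <= X * t) by nra.
assert (X * t <= X * ((c - PI) * r / 16)) by (apply Rmult_le_compat_l; lra).
nra.
Qed.

(** For [c = PI] and [t = PI - th] the modulus is [t / sin t], which tends to
    [1]: the point tends to [-1], where [|w exp w| = 1/e]. *)
Lemma ray_modulus_PI_lim :
  is_lim (fun t => ray_modulus PI (PI - t)) 0 (/ exp 1).
Proof.
apply is_lim_ext with
  (fun t => / (sin t / t) * exp (- cos t * / (sin t / t))).
{ intros t.
  unfold ray_modulus, ray_radius.
  rewrite sin_PI_x, Rtrigo_facts.cos_pi_minus.
  replace (PI - (PI - t)) with t by ring.
  unfold Rdiv; rewrite Rinv_mult, Rinv_inv.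
  f_equal; [ring | f_equal; ring]. }
assert (Hi : is_lim (fun t => / (sin t / t)) 0 1).
{ replace (Finite 1) with (Rbar_inv 1) by (simpl; f_equal; field).
  apply is_lim_inv; [apply is_lim_sinc_0|].
  intros H; injection H; lra. }
assert (Hc : is_lim (fun t => - cos t) 0 (-1)).
{ replace (Finite (-1)) with (Rbar_opp (cos 0)) by (simpl; rewrite cos_0; f_equal; lra).
  apply (is_lim_opp cos 0 (cos 0)).
  apply is_lim_continuity, continuity_cos. }
assert (He : is_lim (fun t => exp (- cos t * / (sin t / t))) 0 (exp (-1 * 1))).
{ apply (is_lim_comp_continuous (fun t => - cos t * / (sin t / t)) exp).
  - apply (is_lim_mult _ _ 0 (-1) 1); [exact Hc | exact Hi | exact I].
  - apply continuity_pt_filterlim, derivable_continuous_pt, derivable_pt_exp. }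
replace (/ exp 1) with (1 * exp (-1 * 1)).
- apply (is_lim_mult _ _ 0 1 (exp (-1 * 1))); [exact Hi | exact He | exact I].
- rewrite Rmult_1_l, <- exp_Ropp; f_equal; lra.
Qed.

Lemma ray_modulus_PI_near (eps d : R) : 0 < eps -> 0 < d ->
  exists t, 0 < t < d /\ Rabs (ray_modulus PI (PI - t) - / exp 1) < eps.
Proof.
intros He Hd.
assert (H := ray_modulus_PI_lim).
apply is_lim_spec in H; destruct (H (mkposreal eps He)) as [e K].
assert (Hp := cond_pos e).
set (t := Rmin (e / 2) (d / 2)).
assert (H0 : 0 < t) by (unfold t; apply Rmin_glb_lt; lra).
assert (H1 : t <= e / 2) by apply Rmin_l.
assert (H2 : t <= d / 2) by apply Rmin_r.
exists t; split; [lra|].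
apply (K t); [|lra].
change (Rabs (t - 0) < e); rewrite Rabs_pos_eq; lra.
Qed.

(** A strictly decreasing function stays above its limit; comparing through the
    midpoint [m] makes the inequality strict. *)
Lemma ray_modulus_PI_gt (th : R) : 0 < th < PI -> / exp 1 < ray_modulus PI th.
Proof.
intros Hth.
set (m := (th + PI) / 2).
assert (H1 : ray_modulus PI m < ray_modulus PI th)
  by (apply ray_modulus_decreasing; unfold m; lra).
destruct (Rlt_le_dec (/ exp 1) (ray_modulus PI th)) as [H | H]; [exact H|].
destruct (ray_modulus_PI_near (/ exp 1 - ray_modulus PI m) (PI - m))
  as [t [Ht K]]; [lra | unfold m; lra |].
assert (H2 : ray_modulus PI (PI - t) < ray_modulus PI m)
  by (apply ray_modulus_decreasing; unfold m in *; lra).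
apply Rabs_def2 in K; lra.
Qed.

(** Intermediate values between a point near [0], where the function is large,
    and a right end that depends on [c]: the zero [c] itself for [c < PI], and
    otherwise a point near [PI], where the function is close to [1/e] for
    [c = PI] and to [0] for [c > PI]. *)
Lemma ray_modulus_surjective (c r : R) :
  0 < c -> 0 < r -> (c = PI -> / exp 1 < r) ->
  exists th, 0 < th < PI /\ th < c /\ ray_modulus c th = r.
Proof.
intros Hc Hr Hcr.
assert (Hpi := PI_RGT_0).
assert (Hend : exists b, 0 < b < PI /\ b <= c /\ ray_modulus c b <= r).
{ destruct (Rtotal_order c PI) as [H | [H | H]].
  - exists c; rewrite ray_modulus_at_end; lra.
  - specialize (Hcr H); subst c.
    destruct (ray_modulus_PI_near (r - / exp 1) PI) as [t [Ht K]]; [lra | lra |].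
    exists (PI - t); apply Rabs_def2 in K; lra.
  - destruct (ray_modulus_small c r H Hr) as [b [Hb K]].
    exists b; lra. }
destruct Hend as [b (Hb & Hbc & Kb)].
destruct (ray_modulus_large c r b Hc Hr ltac:(lra)) as [a [Ha Ka]].
destruct (ivt_between (ray_modulus c) a b r) as [th [Hth E]].
{ lra. }
{ intros t Ht; apply continuity_ray_modulus; lra. }
{ now right. }
exists th; repeat split; try lra.
destruct (Rle_lt_or_eq_dec th c) as [H | H]; [lra | exact H |].
rewrite H, ray_modulus_at_end in E; lra.
Qed.

(** * Modulus and argument *)

Lemma Cmod_polar (r th : R) : 0 <= r -> Cmod (r * cos th, r * sin th) = r.
Proof.
intros Hr; unfold Cmod; simpl.
replace (_ + _) with (r * r * (Rsqr (sin th) + Rsqr (cos th)))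
  by (unfold Rsqr; ring).
rewrite sin2_cos2, Rmult_1_r; now apply sqrt_square.
Qed.

Lemma Carg_polar_upper (r th : R) : 0 < r -> 0 <= th <= PI ->
  Carg (r * cos th, r * sin th) = th.
Proof.
intros Hr Hth; unfold Carg; rewrite Cmod_polar by lra; simpl.
assert (Hs : 0 <= sin th) by (apply sin_ge_0; lra).
destruct Rle_dec as [H | H]; [|exfalso; nra].
replace (r * cos th / r) with (cos th) by (field; lra).
now apply acos_cos.
Qed.

Lemma Carg_RtoC_pos (x : R) : 0 < x -> Carg (RtoC x) = 0.
Proof.
intros Hx; assert (Hpi := PI_RGT_0).
replace (RtoC x) with (x * cos 0, x * sin 0).
- apply Carg_polar_upper; lra.
- rewrite cos_0, sin_0; unfold RtoC; f_equal; ring.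
Qed.

Lemma Carg_RtoC_neg (x : R) : x < 0 -> Carg (RtoC x) = PI.
Proof.
intros Hx; assert (Hpi := PI_RGT_0).
replace (RtoC x) with (- x * cos PI, - x * sin PI).
- apply Carg_polar_upper; lra.
- rewrite cos_PI, sin_PI; unfold RtoC; f_equal; ring.
Qed.

Lemma Im_neq_0_neq_0 (w : C) : Im w <> 0 -> w <> RtoC 0.
Proof. now intros H E; apply H; rewrite E. Qed.

Lemma Carg_Im_pos (w : C) : 0 < Im w -> 0 < Carg w < PI.
Proof.
intros Hi.
assert (Hw : w <> RtoC 0) by (apply Im_neq_0_neq_0; lra).
destruct (Carg_polar w Hw) as [E Hb].
assert (Hr := proj1 (Cmod_gt_0 w) Hw).
assert (E2 : Im w = Cmod w * sin (Carg w)) by (rewrite E at 1; reflexivity).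
assert (H0 : 0 <= Carg w).
{ unfold Carg; destruct Rle_dec as [H | H]; [apply acos_bound | lra]. }
split.
- destruct H0 as [H | H]; [exact H|].
  rewrite <- H, sin_0 in E2; lra.
- destruct (proj2 Hb) as [H | H]; [exact H|].
  rewrite H, sin_PI in E2; lra.
Qed.

Lemma Carg_conj (w : C) : Im w <> 0 -> Carg (Cconj w) = - Carg w.
Proof.
intros Hi; unfold Carg; rewrite Cmod_conj, re_conj, im_conj.
destruct (Rle_dec 0 (- Im w)), (Rle_dec 0 (Im w)); lra.
Qed.

Lemma C_real (w : C) : Im w = 0 -> w = RtoC (Re w).
Proof. destruct w as [x y]; simpl; intros ->; reflexivity. Qed.

Lemma Cconj_RtoC (x : R) : Cconj (RtoC x) = RtoC x.
Proof. unfold Cconj, RtoC; simpl; f_equal; ring. Qed.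

Lemma Carg_PI_iff (z : C) : z <> RtoC 0 -> (Carg z = PI <-> Cneg_ray 0 z).
Proof.
intros Hz; unfold Cneg_ray; split.
- intros E; destruct (Carg_polar z Hz) as [P _].
  assert (Hr := proj1 (Cmod_gt_0 z) Hz).
  rewrite E, cos_PI, sin_PI in P; rewrite P; simpl; split; nra.
- intros [Hi Hr]; rewrite (C_real z Hi); now apply Carg_RtoC_neg.
Qed.

Lemma Cmod_neg_ray (z : C) : Cneg_ray 0 z -> Cmod z = - Re z.
Proof.
intros [Hi Hr]; rewrite (C_real z Hi) at 1.
rewrite Cmod_R; now apply Rabs_left.
Qed.

(** Expressed in polar terms, the cut [[-1/e, 0)] can be compared directly with
    the parameters of [polar_lambert]. *)
Lemma lambert_cut_iff (z : C) : z <> RtoC 0 ->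
  (lambert_cut z <-> Carg z = PI /\ Cmod z <= / exp 1).
Proof.
intros Hz; rewrite (Carg_PI_iff z Hz); split.
- intros [Hi Hr].
  assert (Hn : Cneg_ray 0 z) by (split; [exact Hi | lra]).
  rewrite (Cmod_neg_ray z Hn); split; [exact Hn | lra].
- intros [Hn Hm]; rewrite (Cmod_neg_ray z Hn) in Hm.
  destruct Hn as [Hi Hr]; split; [exact Hi | lra].
Qed.

(** * The equation in polar form *)

(** [w + log w = ln r + i c] in real terms, with the real part exponentiated
    so that no logarithm is left. *)
Definition polar_lambert (r c : R) (w : C) : Prop :=
  w <> RtoC 0 /\ Cmod w * exp (Re w) = r /\ Im w + Carg w = c.

Lemma lambert_eq_polar (z : C) (k : Z) (w : C) : z <> RtoC 0 ->
  (lambert_eq z k w <->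
   polar_lambert (Cmod z) (Carg z + 2 * IZR k * PI) w).
Proof.
intros Hz; unfold lambert_eq, polar_lambert.
assert (Hr := proj1 (Cmod_gt_0 z) Hz).
split; intros [Hw H]; split; try exact Hw; assert (Hm := proj1 (Cmod_gt_0 w) Hw).
- assert (H1 := f_equal Re H); assert (H2 := f_equal Im H).
  simpl in H1, H2; change (fst w) with (Re w) in H1; change (snd w) with (Im w) in H2.
  split; [|lra].
  rewrite <- (exp_ln (Cmod w)), <- exp_plus by exact Hm.
  rewrite <- (exp_ln (Cmod z)) by exact Hr; f_equal; lra.
- destruct H as [H1 H2].
  assert (H3 : ln (Cmod w) + Re w = ln (Cmod z)).
  { rewrite <- H1, ln_mult, ln_exp; [reflexivity | exact Hm | apply exp_pos]. }
  apply injective_projections; simpl;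
    change (fst w) with (Re w); change (snd w) with (Im w); lra.
Qed.

Lemma polar_lambert_upper (r c : R) (w : C) : 0 < Im w ->
  (polar_lambert r c w <->
   exists th, 0 < th < PI /\ th < c /\ ray_modulus c th = r /\
     w = (ray_radius c th * cos th, ray_radius c th * sin th)).
Proof.
intros Hi; split.
- intros (Hw & Hm & Ha).
  destruct (Carg_polar w Hw) as [P _].
  assert (Hb := Carg_Im_pos w Hi).
  assert (Hs : 0 < sin (Carg w)) by (apply sin_gt_0; lra).
  assert (E1 : Re w = Cmod w * cos (Carg w)) by (rewrite P at 1; reflexivity).
  assert (E2 : Im w = Cmod w * sin (Carg w)) by (rewrite P at 1; reflexivity).
  assert (EX : ray_radius c (Carg w) = Cmod w).
  { unfold ray_radius; replace (c - Carg w) with (Im w) by lra.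
    rewrite E2 at 1; field; lra. }
  exists (Carg w); unfold ray_modulus; rewrite EX, <- E1.
  split; [exact Hb | split; [lra | split; [exact Hm|]]].
  rewrite E1; exact P.
- intros (th & Hth & Hc & Hm & E).
  assert (Hs : 0 < sin th) by (apply sin_gt_0; lra).
  assert (HX : 0 < ray_radius c th) by (apply Rdiv_lt_0_compat; lra).
  split; [apply Im_neq_0_neq_0; lra|].
  rewrite E, Cmod_polar, Carg_polar_upper by lra; simpl; split; [exact Hm|].
  unfold ray_radius; field; lra.
Qed.

Lemma polar_lambert_real_pos (r c x : R) : 0 < x ->
  (polar_lambert r c (RtoC x) <-> c = 0 /\ x * exp x = r).
Proof.
intros Hx; unfold polar_lambert.
rewrite Cmod_R, Rabs_pos_eq, Carg_RtoC_pos by lra; simpl.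
split; [intros (_ & H1 & H2); split; lra|].
intros [H1 H2]; repeat split; try lra.
intros H; injection H; lra.
Qed.

Lemma polar_lambert_real_neg (r c x : R) : x < 0 ->
  (polar_lambert r c (RtoC x) <-> c = PI /\ x * exp x = - r).
Proof.
intros Hx; unfold polar_lambert.
rewrite Cmod_R, Rabs_left, Carg_RtoC_neg by lra; simpl.
split; [intros (_ & H1 & H2); split; lra|].
intros [H1 H2]; repeat split; try lra.
intros H; injection H; lra.
Qed.


(** Conjugation changes the sign of the argument except on the negative reals,
    where a solution forces [c = PI] and [r <= 1/e]. *)
Lemma polar_lambert_conj (r c : R) (w : C) :
  polar_lambert r c w -> ~ (c = PI /\ r <= / exp 1) ->
  polar_lambert r (- c) (Cconj w).
Proof.
intros Hp Hc.
destruct (Req_dec (Im w) 0) as [Hi | Hi].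
- rewrite (C_real w Hi) in *; rewrite Cconj_RtoC.
  destruct (Rtotal_order (Re w) 0) as [H | [H | H]].
  + apply polar_lambert_real_neg in Hp; [|exact H].
    assert (K := mul_exp_ge (Re w)); exfalso; apply Hc; lra.
  + rewrite H in Hp; now destruct Hp.
  + apply polar_lambert_real_pos; [exact H|].
    apply polar_lambert_real_pos in Hp; [lra | exact H].
- destruct Hp as (Hw & Hm & Ha); split; [|split].
  + apply Im_neq_0_neq_0; rewrite im_conj; lra.
  + rewrite Cmod_conj, re_conj; exact Hm.
  + rewrite Carg_conj, im_conj by exact Hi; lra.
Qed.

(** The parameters [(r, c)] determine in which of the four parts of the plane (the
    upper and lower half planes, the positive and the negative reals) a
    solution can lie; uniqueness can then be checked part by part. *)
Lemma polar_lambert_position (r c : R) (w : C) : polar_lambert r c w ->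
  (0 < Im w /\ 0 < c /\ (c = PI -> / exp 1 < r)) \/
  (Im w < 0 /\ c < 0 /\ (c = - PI -> / exp 1 < r)) \/
  (Im w = 0 /\ 0 < Re w /\ c = 0 /\ Re w * exp (Re w) = r) \/
  (Im w = 0 /\ Re w < 0 /\ c = PI /\ Re w * exp (Re w) = - r).
Proof.
assert (Hpi := PI_RGT_0).
assert (Hup : forall c w, polar_lambert r c w -> 0 < Im w ->
  0 < c /\ (c = PI -> / exp 1 < r)).
{ intros c' w' Hp Hi; apply polar_lambert_upper in Hp; [|exact Hi].
  destruct Hp as (th & Hth & Hc & Hm & _); split; [lra|].
  intros E; rewrite <- Hm, E; now apply ray_modulus_PI_gt. }
intros Hp; destruct (Rtotal_order (Im w) 0) as [H | [H | H]].
- assert (Hneg : c < 0).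
  { destruct Hp as (Hw & _ & Ha).
    assert (K := Carg_Im_pos (Cconj w)).
    rewrite Carg_conj in K by lra; rewrite im_conj in K.
    lra. }
  right; left.
  assert (K := Hup _ _ (polar_lambert_conj r c w Hp ltac:(lra))).
  rewrite im_conj in K.
  destruct (K ltac:(lra)) as [_ K2]; lra.
- rewrite (C_real w H) in Hp.
  destruct (Rtotal_order (Re w) 0) as [G | [G | G]].
  + apply polar_lambert_real_neg in Hp; [tauto | exact G].
  + rewrite G in Hp; now destruct Hp.
  + apply polar_lambert_real_pos in Hp; [tauto | exact G].
- left; split; [exact H | now apply (Hup c w)].
Qed.

(** The pairs without a solution off the real axis for a nonzero [c]: there is no
    solution at all for [c = - PI], and for [c = PI] there are two real ones,
    which coincide at the boundary value [r = 1/e]. *)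
Definition exceptional (r c : R) : Prop :=
  (c = PI \/ c = - PI) /\ r <= / exp 1.

Lemma polar_lambert_exists (r c : R) : 0 < r -> ~ exceptional r c ->
  exists w, polar_lambert r c w.
Proof.
unfold exceptional; intros Hr.
assert (Hpi := PI_RGT_0).
assert (Hup : forall c, 0 < c -> ~ (c = PI /\ r <= / exp 1) ->
  exists w, polar_lambert r c w).
{ intros c' Hc He.
  destruct (ray_modulus_surjective c' r Hc Hr) as (th & Hth & Hlt & Hm).
  { intros E; apply Rnot_le_lt; intros H; now apply He. }
  exists (ray_radius c' th * cos th, ray_radius c' th * sin th).
  apply polar_lambert_upper; [simpl | now exists th].
  assert (0 < sin th) by (apply sin_gt_0; lra).
  apply Rmult_lt_0_compat; [apply Rdiv_lt_0_compat|]; lra. }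
intros He; destruct (Rtotal_order c 0) as [H | [H | H]].
- destruct (Hup (- c)) as [w Hw]; [lra | intros K; apply He; lra |].
  exists (Cconj w); rewrite <- (Ropp_involutive c).
  apply polar_lambert_conj; [exact Hw | intros K; apply He; lra].
- destruct (mul_exp_positive_root r Hr) as [u [Hu E]].
  exists (RtoC u); now apply polar_lambert_real_pos.
- apply Hup; [exact H | intros K; apply He; lra].
Qed.

Lemma polar_lambert_inj (r c : R) (w w' : C) : ~ exceptional r c ->
  polar_lambert r c w -> polar_lambert r c w' -> w = w'.
Proof.
assert (Hpi := PI_RGT_0).
assert (Hup : forall c w w', 0 < Im w -> 0 < Im w' ->
  polar_lambert r c w -> polar_lambert r c w' -> w = w').
{ clear c w w'; intros c w w' Hi Hi' Hp Hp'.
  apply polar_lambert_upper in Hp, Hp'; try assumption.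
  destruct Hp as (th & Hth & _ & Hm & ->), Hp' as (th' & Hth' & _ & Hm' & ->).
  rewrite (ray_modulus_inj c th th'); congruence. }
unfold exceptional; intros He Hp Hp'.
assert (T := polar_lambert_position r c w Hp).
assert (T' := polar_lambert_position r c w' Hp').
assert (Hge : forall x, x * exp x = - r -> r <= / exp 1).
{ intros x E; assert (K := mul_exp_ge x); lra. }
destruct (Rtotal_order c 0) as [H | [H | H]].
- rewrite <- (Cconj_conj w), <- (Cconj_conj w'); f_equal.
  apply (Hup (- c)); rewrite ?im_conj; try lra.
  + apply polar_lambert_conj; [exact Hp | lra].
  + apply polar_lambert_conj; [exact Hp' | lra].
- rewrite (C_real w), (C_real w') by lra; f_equal.
  apply mul_exp_inj_right; lra.
- assert (N : ~ (c = PI /\ exists x, x * exp x = - r)).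
  { intros (E & x & K); apply He; split; [now left | now apply Hge in K]. }
  apply (Hup c); try assumption.
  + destruct T as [T | [T | [T | T]]]; try lra.
    exfalso; apply N; split; [tauto | now exists (Re w)].
  + destruct T' as [T' | [T' | [T' | T']]]; try lra.
    exfalso; apply N; split; [tauto | now exists (Re w')].
Qed.

Lemma polar_lambert_none (r : R) (w : C) : r <= / exp 1 ->
  ~ polar_lambert r (- PI) w.
Proof.
intros Hr Hp; assert (Hpi := PI_RGT_0).
destruct (polar_lambert_position r (- PI) w Hp) as [T | [T | [T | T]]]; lra.
Qed.

Lemma polar_lambert_PI_real (r : R) (w : C) : r <= / exp 1 ->
  polar_lambert r PI w -> Im w = 0 /\ Re w * exp (Re w) = - r.
Proof.
intros Hr Hp; assert (Hpi := PI_RGT_0).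
destruct (polar_lambert_position r PI w Hp) as [T | [T | [T | T]]]; lra.
Qed.

(** * The branches [W_k] *)

Lemma Carg_2kPI_eq_PI (z : C) (k : Z) : z <> RtoC 0 ->
  (Carg z + 2 * IZR k * PI = PI <-> Carg z = PI /\ k = 0%Z).
Proof.
intros Hz; destruct (Carg_polar z Hz) as [_ Hb]; assert (Hpi := PI_RGT_0).
split; [|intros [-> ->]; simpl; lra].
intros E.
assert (H1 : -1 < IZR k) by nra.
assert (H2 : IZR k < 1) by nra.
apply lt_IZR in H1, H2.
assert (Hk : k = 0%Z) by lia.
subst k; split; [lra | reflexivity].
Qed.

Lemma Carg_2kPI_eq_mPI (z : C) (k : Z) : z <> RtoC 0 ->
  (Carg z + 2 * IZR k * PI = - PI <-> Carg z = PI /\ k = (-1)%Z).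
Proof.
intros Hz; destruct (Carg_polar z Hz) as [_ Hb]; assert (Hpi := PI_RGT_0).
split; [|intros [-> ->]; simpl; lra].
intros E.
assert (H1 : -2 < IZR k) by nra.
assert (H2 : IZR k < 0) by nra.
apply lt_IZR in H1, H2.
assert (Hk : k = (-1)%Z) by lia.
subst k; split; [lra | reflexivity].
Qed.

Lemma exceptional_iff (z : C) (k : Z) : z <> RtoC 0 ->
  (exceptional (Cmod z) (Carg z + 2 * IZR k * PI) <->
   lambert_cut z /\ (k = 0%Z \/ k = (-1)%Z)).
Proof.
intros Hz; unfold exceptional.
rewrite Carg_2kPI_eq_PI, Carg_2kPI_eq_mPI, lambert_cut_iff by exact Hz; tauto.
Qed.

Lemma lambertW_spec (k : Z) (z : C) :
  (exists w, is_lambertW k z w) -> is_lambertW k z (lambertW k z).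
Proof. exact (epsilon_spec _ _). Qed.

Lemma lambertW_unique (z : C) (k : Z) : z <> RtoC 0 ->
  ~ (lambert_cut z /\ (k = 0%Z \/ k = (-1)%Z)) ->
  unique (lambert_eq z k) (lambertW k z).
Proof.
intros Hz He.
assert (Hx : ~ exceptional (Cmod z) (Carg z + 2 * IZR k * PI))
  by now rewrite exceptional_iff.
assert (HW : lambert_eq z k (lambertW k z)).
{ destruct (polar_lambert_exists _ _ (proj1 (Cmod_gt_0 z) Hz) Hx) as [w Hw].
  assert (HS : is_lambertW k z (lambertW k z)).
  { apply lambertW_spec; exists w; right; right.
    now rewrite lambert_eq_polar. }
  destruct HS as [HS | [HS | HS]]; tauto. }
split; [exact HW|].
intros w Hw; rewrite lambert_eq_polar in HW, Hw by exact Hz.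
exact (polar_lambert_inj _ _ _ _ Hx HW Hw).
Qed.

Lemma lambert_eq_cut (z : C) (w : C) : z <> RtoC 0 -> lambert_cut z ->
  (lambert_eq z 0 w <-> exists x, w = RtoC x /\ x * exp x = - Cmod z).
Proof.
intros Hz Hcut; destruct (proj1 (lambert_cut_iff z Hz) Hcut) as [Ha Hm].
assert (Hr := proj1 (Cmod_gt_0 z) Hz).
rewrite lambert_eq_polar, (proj2 (Carg_2kPI_eq_PI z 0 Hz)) by tauto.
split.
- intros Hp; destruct (polar_lambert_PI_real _ _ Hm Hp) as [Hi E].
  exists (Re w); split; [now apply C_real | exact E].
- intros (x & -> & E).
  assert (Hx : x < 0) by (assert (He := exp_pos x); nra).
  now apply polar_lambert_real_neg.
Qed.

Lemma lambertW_cut (z : C) : z <> RtoC 0 -> lambert_cut z ->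
  exists a b, lambertW (-1) z = RtoC a /\ lambertW 0 z = RtoC b /\
    a <= -1 <= b /\ a * exp a = - Cmod z /\ b * exp b = - Cmod z.
Proof.
intros Hz Hcut.
destruct (proj1 (lambert_cut_iff z Hz) Hcut) as [_ Hm].
assert (Hr := proj1 (Cmod_gt_0 z) Hz).
destruct (mul_exp_two_roots (Cmod z)) as (a & b & Hab & Ea & Eb); [lra|].
assert (H1 : is_lambertW (-1) z (lambertW (-1) z)).
{ apply lambertW_spec; exists (RtoC a); right; left.
  rewrite lambert_eq_cut by assumption.
  repeat split; try apply Hcut; [now exists a | simpl; lra]. }
assert (H0 : is_lambertW 0 z (lambertW 0 z)).
{ apply lambertW_spec; exists (RtoC b); left.
  rewrite lambert_eq_cut by assumption.
  repeat split; try apply Hcut; [now exists b | simpl; lra]. }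
assert (L1 : lambert_eq z 0 (lambertW (-1) z) /\ Re (lambertW (-1) z) <= -1).
{ destruct H1 as [H | [H | [H _]]]; [destruct H as (_ & H & _); discriminate | tauto |].
  exfalso; apply H; tauto. }
assert (L0 : lambert_eq z 0 (lambertW 0 z) /\ -1 <= Re (lambertW 0 z)).
{ destruct H0 as [H | [H | [H _]]]; [tauto | destruct H as (_ & H & _); discriminate |].
  exfalso; apply H; tauto. }
clear H1 H0; destruct L1 as [L1 K1], L0 as [L0 K0].
apply lambert_eq_cut in L1, L0; try assumption.
destruct L1 as (a' & Ra & Ea'), L0 as (b' & Rb & Eb').
rewrite Ra in K1; rewrite Rb in K0; simpl in K1, K0.
exists a', b'; tauto.
Qed.

Lemma Carg_conj_off_ray (z : C) : z <> RtoC 0 -> ~ Cneg_ray 0 z ->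
  Carg (Cconj z) = - Carg z.
Proof.
intros Hz Hn; destruct (Req_dec (Im z) 0) as [Hi | Hi]; [|now apply Carg_conj].
assert (Hx : 0 < Re z).
{ destruct (Rtotal_order (Re z) 0) as [H | [H | H]]; [|exfalso | exact H].
  - exfalso; apply Hn; now split.
  - apply Hz; rewrite (C_real z Hi); now rewrite H. }
rewrite (C_real z Hi), Cconj_RtoC, Carg_RtoC_pos by exact Hx; lra.
Qed.

(** The common source of both conjugation formulas: the pairs [(z, k)] and
    [(z', k')] lead to the same [r] and to opposite [c], and uniqueness identifies the
    conjugate of the solution for one with the solution for the other. *)
Lemma lambertW_conj (z z' : C) (k k' : Z) : z <> RtoC 0 -> z' <> RtoC 0 ->
  ~ (lambert_cut z /\ (k = 0%Z \/ k = (-1)%Z)) ->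
  Cmod z' = Cmod z ->
  Carg z' + 2 * IZR k' * PI = - (Carg z + 2 * IZR k * PI) ->
  lambertW k' z' = Cconj (lambertW k z).
Proof.
intros Hz Hz' He Em Ea.
assert (Hx : ~ exceptional (Cmod z) (Carg z + 2 * IZR k * PI))
  by now rewrite exceptional_iff.
assert (Hx' : ~ exceptional (Cmod z') (Carg z' + 2 * IZR k' * PI)).
{ rewrite Em, Ea; unfold exceptional in *; intros K; apply Hx; lra. }
assert (He' : ~ (lambert_cut z' /\ (k' = 0%Z \/ k' = (-1)%Z)))
  by now rewrite <- exceptional_iff.
apply (lambertW_unique z' k' Hz' He').
rewrite lambert_eq_polar, Em, Ea by exact Hz'.
apply polar_lambert_conj.
- rewrite <- lambert_eq_polar by exact Hz; now apply lambertW_unique.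
- intros K; apply Hx; unfold exceptional; tauto.
Qed.

Theorem proposition1p1 (z : C) (hz : z <> RtoC 0) (k : Z) :
  (* (1) *)
  (~ Cneg_ray 0 z ->
     unique (lambert_eq z k) (lambertW k z) /\
     lambertW (- k) z = Cconj (lambertW k (Cconj z))) /\
  (* (2); for k = 1 and z in ]-1/e, 0[ the values W_{-1}(z) and W_0(z) are the
     two distinct reals of (4), so the conjugation formula excludes that case *)
  ((Cneg_ray 0 z /\ k <> 0%Z /\ k <> (-1)%Z) \/
   (Cneg_ray (- / exp 1) z /\ (k = 0%Z \/ k = (-1)%Z)) ->
     unique (lambert_eq z k) (lambertW k z) /\
     (~ (k = 1%Z /\ Im z = 0 /\ - / exp 1 < Re z < 0) ->
        lambertW (- k) z = Cconj (lambertW (k - 1) z))) /\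
  (* (3) *)
  ((~ exists w : C, lambert_eq z k w) <-> (lambert_cut z /\ k = (-1)%Z)) /\
  (* (4) *)
  (lambert_cut z -> k = 0%Z ->
     exists a b : R,
       lambertW (-1) z = RtoC a /\ lambertW 0 z = RtoC b /\
       a <= -1 <= b /\
       (forall w : C, lambert_eq z k w <-> (w = RtoC a \/ w = RtoC b)) /\
       (forall x : R, lambert_eq z k (RtoC x) -> x <= -1 -> x = a) /\
       (forall x : R, lambert_eq z k (RtoC x) -> -1 <= x -> x = b) /\
       (a = b <-> z = RtoC (- / exp 1))).
Proof.
assert (He := Rinv_0_lt_compat _ (exp_pos 1)).
assert (Hm1 := mul_exp_m1).
split; [|split; [|split]].
- intros Hn.
  assert (Hcut : forall v, Im v = Im z \/ Im v = - Im z -> Re v = Re z ->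
    ~ lambert_cut v).
  { intros v Hi Hr [Hi' Hr']; apply Hn; split; lra. }
  split.
  + apply lambertW_unique; [exact hz|].
    intros [H _]; now apply (Hcut z); [left | |].
  + assert (Hz' : Cconj z <> RtoC 0).
    { intros H; apply hz; rewrite <- (Cconj_conj z), H; apply Cconj_RtoC. }
    apply lambertW_conj; try assumption.
    * intros [H _]; now apply (Hcut (Cconj z)); [right | |].
    * now rewrite Cmod_conj.
    * rewrite Carg_conj_off_ray, opp_IZR by assumption; ring.
- intros H.
  assert (Hn : Cneg_ray 0 z) by (destruct H as [H | [[Hi Hr] _]]; [tauto | split; lra]).
  assert (Hcut : lambert_cut z -> k <> 0%Z /\ k <> (-1)%Z).
  { intros [Hi Hr]; destruct H as [H | [[Hi' Hr'] _]]; [tauto | lra]. }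
  split; [apply lambertW_unique; tauto|].
  intros Hk.
  assert (Hcases : lambert_cut z /\ k = 1%Z \/
    ~ (lambert_cut z /\ ((k - 1)%Z = 0%Z \/ (k - 1)%Z = (-1)%Z))).
  { destruct (Z.eq_dec k 1) as [E | E].
    - destruct (excluded_middle_informative (lambert_cut z)); tauto.
    - right; intros [K Hk']; apply Hcut in K; lia. }
  destruct Hcases as [[K ->] | Hnx].
  (* Only [z = -1/e] is left in the exceptional case: there the two real roots
     coincide with [-1]. *)
  + assert (Hr : Re z = - / exp 1).
    { destruct K as [Hi Hr]; destruct (Rle_lt_or_eq_dec _ _ (proj1 Hr)) as [G | G].
      - exfalso; apply Hk; split; [reflexivity | lra].
      - now symmetry. }
    destruct (lambertW_cut z hz K) as (a & b & Ea & Eb & Hab & Fa & Fb).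
    rewrite (Cmod_neg_ray z Hn) in Fa, Fb.
    change (lambertW (-1) z = Cconj (lambertW 0 z)).
    rewrite Ea, Eb, Cconj_RtoC; f_equal.
    rewrite (mul_exp_inj_left a (-1)), (mul_exp_inj_right b (-1)); lra.
  + apply lambertW_conj; try assumption; [reflexivity|].
    rewrite (proj2 (Carg_PI_iff z hz) Hn), opp_IZR, minus_IZR; ring.
- split.
  + intros Hno.
    destruct (excluded_middle_informative (lambert_cut z)) as [K | K].
    * split; [exact K|].
      destruct (Z.eq_dec k (-1)) as [E | E]; [exact E|]; exfalso; apply Hno.
      destruct (Z.eq_dec k 0) as [-> | E0].
      -- destruct (lambertW_cut z hz K) as (a & b & _ & _ & _ & Ea & _).
         exists (RtoC a); apply lambert_eq_cut; try assumption; now exists a.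
      -- exists (lambertW k z); apply lambertW_unique; tauto.
    * exfalso; apply Hno.
      exists (lambertW k z); apply lambertW_unique; tauto.
  + intros [K ->] [w Hw].
    apply lambert_cut_iff in K; [|exact hz].
    rewrite lambert_eq_polar, (proj2 (Carg_2kPI_eq_mPI z (-1) hz)) in Hw by tauto.
    now apply polar_lambert_none in Hw.
- intros K ->.
  destruct (lambertW_cut z hz K) as (a & b & Wa & Wb & Hab & Ea & Eb).
  assert (Heq := fun w => lambert_eq_cut z w hz K).
  assert (Hroot : forall x, lambert_eq z 0 (RtoC x) -> x * exp x = - Cmod z).
  { intros x Hx; apply Heq in Hx; destruct Hx as (y & Hy & E).
    injection Hy as ->; exact E. }
  assert (Ha : forall x, x * exp x = - Cmod z -> x <= -1 -> x = a)
    by (intros; apply mul_exp_inj_left; lra).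
  assert (Hb : forall x, x * exp x = - Cmod z -> -1 <= x -> x = b)
    by (intros; apply mul_exp_inj_right; lra).
  exists a, b; repeat match goal with |- _ /\ _ => split end; try tauto; try lra.
  + intros w; rewrite Heq; split.
    * intros (x & -> & E); destruct (Rle_dec x (-1)) as [H | H].
      -- left; f_equal; now apply Ha.
      -- right; f_equal; apply Hb; [exact E | lra].
    * intros [-> | ->]; [now exists a | now exists b].
  + intros x Hx; apply Ha; auto.
  + intros x Hx; apply Hb; auto.
  + assert (Hn : Cneg_ray 0 z) by (destruct K; split; lra).
    rewrite (Cmod_neg_ray z Hn) in Ea, Eb.
    split.
    * intros E; assert (E1 : a = -1) by lra.
      rewrite (C_real z) by apply Hn; f_equal; rewrite E1 in Ea; lra.
    * intros E; assert (Er : Re z = - / exp 1) by now rewrite E.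
      rewrite (mul_exp_inj_left a (-1)), (mul_exp_inj_right b (-1)); lra.
Qed.
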